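(* Let $n \ge 2$ be an integer and let $p_0 = \frac{n\log n - (n-1)\log(n-1)}{\log n}$. Then for every $p$ with $p_0 \le p \le 2$, $$\max\left\{1,\frac{n!}{n^{n/p}}\right\} \le U(n,p) \le \exp\left\{\frac{p-1}{p}\, e^{1/(p-1)}\right\}\cdot \frac{n!}{n^{n/p}}.$$
   Context: For $n\ge 1$ and $1 \le p \le \infty$, $U(n,p)$ denotes the maximum of $\mathrm{per}(A)=\sum_{\sigma\in S_n}\prod_{i=1}^n a_{i\sigma(i)}$ over all real $n\times n$ matrices $A$ each of whose rows has $\ell_p$-norm equal to $1$. *)

(* Defs.v *)
From mathcomp Require Import all_boot all_order all_algebra all_fingroup.
From mathcomp Require Import all_classical all_reals all_analysis.
Set Implicit Arguments. Unset Strict Implicit. Unset Printing Implicit Defensive.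
Import Order.TTheory GRing.Theory Num.Theory.
Local Open Scope ring_scope.
Local Open Scope classical_set_scope.

Definition per {R : realType} (n : nat) (A : 'M[R]_n) : R :=
  \sum_(s : 'S_n) \prod_(i < n) A i (s i).

Definition row_lpnorm {R : realType} (n : nat) (p : R) (A : 'M[R]_n) (i : 'I_n) : R :=
  (\sum_(j < n) `|A i j| `^ p) `^ p^-1.

Definition U {R : realType} (n : nat) (p : R) : R :=
  sup [set per A | A in [set A : 'M[R]_n | forall i, row_lpnorm p A i = 1]].

(* Main.v *)
(* Let G_n = n!/n^(n/p).  Expanding the permanent along each of the n rows and
   summing the n expansions reduces the step from n-1 to n to an inequality
   about one column: after normalisation,
     sum_i x_i <= max(1, G_n/G_(n-1)) prod_i (1 + x_i^p)^(1/p)   (x_i >= 0).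
   Since ln(1 + x^p) is convex then concave, it suffices to treat the tuples
   (b, a, ..., a); Hoelder's inequality eliminates b, and a one-variable
   inequality remains.  When G_n/G_(n-1) < 1 the column inequality follows from
   the case of the larger exponent p' (the p_0 of the theorem for that n) at
   which this ratio is 1, by subadditivity of x^(p/p').  Hence, up to sizes
   where the ratio is at most 1, the permanent is at most 1, and afterwards its
   bound grows exactly like G_n; the factor in the theorem is the maximum of
   1/G_N, estimated by N! >= (N/e)^N. *)
Require Import Defs.
From mathcomp Require Import all_boot all_order all_algebra all_fingroup.
From mathcomp Require Import all_classical all_reals all_analysis.
From mathcomp Require Import ring lra.
Set Implicit Arguments. Unset Strict Implicit. Unset Printing Implicit Defensive.
Import Order.TTheory GRing.Theory Num.Theory.
Import numFieldNormedType.Exports.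
Local Open Scope ring_scope.

Section RealInequalities.
Context {R : realType}.
Implicit Types (x y a b c p q r s w : R) (t : seq R).

(** * Calculus of logarithms and real powers *)

Lemma MVT_pos (f df : R -> R) a b : 0 < a -> a < b ->
  (forall x, 0 < x -> is_derive x 1 f (df x)) ->
  exists2 c, a < c < b & f b - f a = df c * (b - a).
Proof.
move=> a0 ab dfP.
have [||c] := @MVT R f df a b ab.
- by move=> x; rewrite in_itv /= => /andP[ax _]; apply: dfP; apply: lt_trans ax.
- apply: derivable_within_continuous => x; rewrite in_itv /= => /andP[ax _].
  by have [] := dfP x (lt_le_trans a0 ax).
by rewrite in_itv /= => abc ->; exists c.
Qed.

Lemma ln_leB1 x : 0 < x -> ln x <= x - 1.
Proof.
move=> x0; have := @le_ln1Dx R (x - 1).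
by rewrite (_ : 1 + (x - 1) = x); [apply; lra | ring].
Qed.

Lemma powR_split x s : 0 < x -> x `^ s = x * x `^ (s - 1).
Proof.
move=> x0; rewrite -[X in X * _](powRr1 (ltW x0)) -powRD; first by congr (_ `^ _); ring.
by rewrite (gt_eqF x0) implybT.
Qed.

(** After scaling to a = 1, z^s = exp (s ln z) >= 1 + s ln z >= 1 + s (z - 1); the last step
    combines s <= 0 with ln z <= z - 1. *)
Lemma powR_tangent s x a : s <= 0 -> 0 < x -> 0 < a ->
  a `^ s + s * a `^ (s - 1) * (x - a) <= x `^ s.
Proof.
move=> s0 x0 a0; set z := x / a; have z0 : 0 < z by rewrite divr_gt0.
have -> : x = z * a by rewrite divfK // gt_eqF.
rewrite powRM ?(ltW z0) ?(ltW a0) // (powR_split s a0).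
rewrite (_ : _ + _ = (1 + s * (z - 1)) * (a * a `^ (s - 1))); last by ring.
rewrite ler_wpM2r ?mulr_ge0 ?powR_ge0 ?(ltW a0) // /powR gt_eqF //.
apply: le_trans (expR_ge1Dx _).
by rewrite lerD2l ler_wnM2l // ln_leB1.
Qed.

Lemma is_derive_ln1DMpowR (m p x : R) : 0 <= m -> 0 < x ->
  is_derive x 1 (fun y => ln (1 + m * y `^ p))
    (m * p * x `^ (p - 1) / (1 + m * x `^ p)).
Proof.
move=> m0 x0; have pos : 0 < 1 + m * x `^ p.
  by rewrite ltr_pwDl // mulr_ge0 // powR_ge0.
have d1 : is_derive x 1 (fun y => 1 + m * y `^ p) (m * (p * x `^ (p - 1))).
  have := is_derive1_powR p x0 => d.
  by apply: is_derive_eq; rewrite /GRing.scale /=; ring.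
have := is_derive1_ln pos => d2.
have d := @is_derive1_comp R (@ln R) (fun y => 1 + m * y `^ p) x _ _ d2 d1.
by apply: is_derive_eq; field; rewrite gt_eqF.
Qed.

Lemma is_derive_lnDc (m x : R) : 0 <= m -> 0 < x ->
  is_derive x 1 (fun y => ln (m + y)) (m + x)^-1.
Proof.
move=> m0 x0; have pos : 0 < m + x by lra.
have d1 : is_derive x 1 (fun y => m + y) 1.
  by apply: is_derive_eq; rewrite add0r mulr1.
have := is_derive1_ln pos => d2.
have := @is_derive1_comp R (@ln R) (fun y => m + y) x _ _ d2 d1.
by rewrite mulr1.
Qed.

(** * The one-variable inequality *)

Lemma bernoulli (x : R) n : 0 <= x -> 1 + x *+ n <= (1 + x) ^+ n.
Proof.
move=> x0; elim: n => [|n IH]; first by rewrite mulr0n addr0 expr0.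
rewrite exprS; have xn : 0 <= x *+ n by rewrite mulrn_wge0.
apply: (@le_trans _ _ ((1 + x) * (1 + x *+ n))).
  by rewrite mulrS; nra.
by rewrite ler_wpM2l //; lra.
Qed.

(** Bernoulli's inequality gives (1 + 1/m)^(m^2) >= 1 + m; take logarithms. *)
Lemma ln_natS_ub (m : nat) : (0 < m)%N ->
  ln (m.+1%:R : R) <= m%:R ^+ 2 * (ln m.+1%:R - ln m%:R).
Proof.
move=> m0; have m0R : 0 < m%:R :> R by rewrite ltr0n.
have -> : ln m.+1%:R - ln m%:R = ln (1 + m%:R^-1) :> R.
  rewrite -ln_div ?posrE ?ltr0n //; congr ln.
  by rewrite -natr1; field; rewrite gt_eqF.
have i0 : 0 < m%:R^-1 :> R by rewrite invr_gt0.
rewrite -[_ ^+ 2]natrX mulr_natl -lnXn ?addr_gt0 //.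
rewrite ler_ln ?posrE ?ltr0n ?exprn_gt0 ?addr_gt0 //.
apply: le_trans (bernoulli _ (ltW i0)).
by rewrite -[m%:R^-1 *+ _]mulr_natl natrX -nat1r lerD2l expr2 mulfK // gt_eqF.
Qed.

(* The difference of the two sides is a function of [w] whose derivative has the
   sign of the convex function [phi], which vanishes at 1. So its minimum is
   reached at [w = 0], where [hr] applies, or at [w = 1]. *)
Lemma one_variable_ineq (m : nat) r w : (0 < m)%N -> 1 <= r -> 0 < w ->
  m%:R * r * (ln m.+1%:R - ln m%:R) <= ln (m.+1%:R : R) ->
  m%:R * r * ln m.+1%:R - ln m.+1%:R
    <= m%:R * r * ln (m%:R + w) - ln (1 + m%:R * w `^ r).
Proof.
move=> m0 r1 w0 hr.
have m1 : 1 <= m%:R :> R by rewrite ler1n.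
have mS : m.+1%:R = m%:R + 1 :> R by rewrite -natr1.
have lnlt : 0 < ln m.+1%:R - ln m%:R :> R.
  by rewrite subr_gt0 ltr_ln ?posrE ?ltr0n // mS; lra.
(* For r > m, [hr] would contradict [ln_natS_ub]. The bound makes the slope m - r of [phi] at 1
   nonnegative. *)
have rm : r <= m%:R.
  rewrite leNgt; apply/negP => mr.
  have : 0 < m%:R * (r - m%:R) * (ln m.+1%:R - ln m%:R) :> R.
    by rewrite !mulr_gt0 //; lra.
  have := ln_natS_ub m0; lra.
pose h x := m%:R * r * ln (m%:R + x) - ln (1 + m%:R * x `^ r).
(* Up to a positive factor [phi] is the derivative of [h]. It is convex because 1 - r <= 0, and [D]
   below is its derivative. *)
pose phi x := x `^ (1 - r) + (m%:R - 1) * x - m%:R.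
pose dh x := m%:R * r * (m%:R + x)^-1 - m%:R * r * x `^ (r - 1) / (1 + m%:R * x `^ r).
have hd x : 0 < x -> is_derive x 1 h (dh x).
  move=> x0.
  have d1 := is_derive_ln1DMpowR r (ltW (lt_le_trans ltr01 m1)) x0.
  have d2 := is_derive_lnDc (ltW (lt_le_trans ltr01 m1)) x0.
  by apply: is_derive_eq.
have dhE x : 0 < x -> exists2 k : R, 0 < k & dh x = k * phi x.
  move=> x0; have xr := powR_gt0 r x0.
  have xr1 := powR_gt0 (r - 1) x0.
  exists (m%:R * r * x `^ (r - 1) / ((m%:R + x) * (1 + m%:R * x `^ r))).
    have H : 0 < m%:R * x `^ r by rewrite mulr_gt0 //; lra.
    by rewrite divr_gt0 ?mulr_gt0 //; lra.
  rewrite /dh /phi (_ : x `^ (1 - r) = (x `^ (r - 1))^-1); last first.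
    by rewrite -powRN; congr (_ `^ _); ring.
  rewrite (powR_split r x0); field.
  have H : 0 < m%:R * (x * x `^ (r - 1)) by rewrite !mulr_gt0 //; lra.
  by rewrite !gt_eqF //; lra.
have phi1 : phi 1 = 0 by rewrite /phi powR1; ring.
pose D a : R := (1 - r) * a `^ (1 - r - 1) + (m%:R - 1).
have D1 : D 1 = m%:R - r by rewrite /D powR1; ring.
have tan x a : 0 < x -> 0 < a -> phi a + D a * (x - a) <= phi x.
  move=> x0 a0; have := powR_tangent _ x0 a0 => /(_ (1 - r)) H.
  rewrite /phi /D; have {H} := H ltac:(lra); lra.
clearbody phi dh D.
have h1 : h 1 = m%:R * r * ln m.+1%:R - ln m.+1%:R.
  by rewrite /h powR1 mulr1 [1 + _]addrC -mS.
rewrite -h1 -/(h w) leNgt; apply/negP => hw.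
have [w1|w1|w1] := ltgtP w 1; last by rewrite w1 ltxx in hw.
- pose d := h 1 - h w.
  have d0 : 0 < d by rewrite subr_gt0.
  (* By [hr], m r ln m >= h 1, while ln (1 + m e^r) <= m e; hence h e >= h 1 - m e, and m e < d
     gives h e > h w. *)
  have [e [e0 ew med]] : exists e : R, [/\ 0 < e, e < w & m%:R * e < d].
    have m0R : 0 < m%:R :> R by rewrite ltr0n.
    exists (Num.min (w / 2) (d / (2 * m%:R))); split.
    - by rewrite lt_min !divr_gt0 // mulr_gt0.
    - by rewrite gt_min; apply/orP; left; move: w0; clear; lra.
    - have : Num.min (w / 2) (d / (2 * m%:R)) <= d / (2 * m%:R).
        by rewrite ge_min lexx orbT.
      rewrite ler_pdivlMr; last by rewrite mulr_gt0.
      by move: d0; clear; lra.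
  have he : h w < h e.
    have er : e `^ r <= e by apply: ge1r_powR => //; rewrite e0 ltW // (lt_trans ew).
    have : ln (1 + m%:R * e `^ r) <= m%:R * e.
      apply: (@le_trans _ _ (m%:R * e `^ r)).
        by apply: le_ln1Dx; rewrite (lt_le_trans (ltrN10 R)) // mulr_ge0 ?powR_ge0.
      by rewrite ler_wpM2l.
    have : ln m%:R <= ln (m%:R + e) by rewrite ler_ln ?posrE ?addr_gt0 ?ltr0n // lerDl ltW.
    have mr : 0 <= m%:R * r by rewrite mulr_ge0 // ltW // (lt_le_trans ltr01).
    move=> /(ler_wpM2l mr); move: hr; rewrite /d h1 in med; rewrite /h in med *.
    by move: med; clear; lra.
  have [c1 /andP[ec1 c1w] E1] := MVT_pos e0 ew hd.
  have [c2 /andP[wc2 c21] E2] := MVT_pos w0 w1 hd.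
  have c10 : 0 < c1 by apply: lt_trans ec1.
  have c20 : 0 < c2 by apply: lt_trans wc2.
  have [k1 k10 K1] := dhE _ c10; have [k2 k20 K2] := dhE _ c20.
  (* Since [h] drops from e to w and climbs from w to 1, [phi] is negative at [c1], positive at [c2]
     and 0 at 1, against convexity. *)
  have p1 : phi c1 < 0.
    have : k1 * phi c1 * (w - e) < 0 by rewrite -K1 -E1 subr_lt0.
    by rewrite pmulr_llt0 ?subr_gt0 // pmulr_rlt0.
  have p2 : 0 < phi c2.
    have : 0 < k2 * phi c2 * (1 - w) by rewrite -K2 -E2 subr_gt0.
    by rewrite pmulr_lgt0 ?subr_gt0 // pmulr_rgt0.
  have := tan _ _ c10 c20; have := tan _ _ ltr01 c20; rewrite phi1.
  have c12 : c1 < c2 by apply: lt_trans wc2.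
  move: p1 p2 c12 c21; clear.
  move: (phi c1) (phi c2) (D c2) => u v {}D u0 v0 c12 c21 t1 t2.
  have D0 : D < 0.
    have : D * (1 - c2) < 0 by lra.
    by rewrite pmulr_llt0 // subr_gt0.
  have : 0 < D * (c1 - c2) by rewrite nmulr_lgt0 // subr_lt0.
  lra.
- have [c /andP[c1 cw] E1] := MVT_pos ltr01 w1 hd.
  have c0 : 0 < c by apply: lt_trans c1.
  have [k k0 K] := dhE _ c0.
  (* The tangent of [phi] at 1 has slope m - r >= 0, so [phi] is nonnegative beyond 1 and [h] cannot
     drop from 1 to w. *)
  have := tan _ _ c0 ltr01; rewrite phi1 D1 => t.
  have p0 : 0 <= phi c.
    have : 0 <= (m%:R - r) * (c - 1) by rewrite mulr_ge0 // subr_ge0 // ltW.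
    by move: t; clear; lra.
  have : k * phi c * (w - 1) < 0 by rewrite -K -E1 subr_lt0.
  by apply/negP; rewrite -leNgt !mulr_ge0 ?subr_ge0 // ltW.
Qed.

(* The logarithm of G_(m+1)/G_m, where G_n = n!/n^(n/p). *)
Definition ln_step (m : nat) p : R :=
  ((p - 1) * ln m.+1%:R + m%:R * (ln m%:R - ln m.+1%:R)) / p.

(** * The column inequality for tuples (b, a, ..., a) *)

(** Hoelder's inequality on the vectors (b, 1) and (1, m a) splits off (1 + b^p)^(1/p), which
    cancels against the same factor on the right and leaves an inequality in [a] alone. *)
Lemma two_values (m : nat) p a b : (0 < m)%N -> 1 < p -> p <= 2 ->
  0 <= a -> 0 <= b -> 0 <= ln_step m p ->
  b + m%:R * a
    <= expR (ln_step m p) * ((1 + b `^ p) * (1 + a `^ p) ^+ m) `^ p^-1.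
Proof.
move=> m0 p1 p2 a0 b0 K0.
have p0 : 0 < p by apply: lt_trans p1.
have q0 : 0 < p - 1 by rewrite subr_gt0.
have pq : 0 < p / (p - 1) by rewrite divr_gt0.
have mR : 0 < m%:R :> R by rewrite ltr0n.
have ap := powR_ge0 a p; have bp := powR_ge0 b p.
have ap1 : 0 < 1 + a `^ p by rewrite ltr_pwDl.
rewrite powRM ?addr_ge0 ?exprn_ge0 ?(ltW ap1) //.
have := @hoelder2 R b 1 1 (m%:R * a) p (p / (p - 1)) b0 ler01 ler01.
rewrite !powR1 mulr1 mul1r [b `^ p + 1]addrC => H.
apply: le_trans (H _ p0 pq _) _; first by rewrite mulr_ge0 // ltW.
  by field; rewrite !gt_eqF.
rewrite [leRHS]mulrCA ler_wpM2l ?powR_ge0 //.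
have [a00|an0] := eqVneq a 0.
  rewrite a00 mulr0 !powR0 ?gt_eqF // !addr0 expr1n !powR1 mulr1.
  by rewrite -expR0 ler_expR.
have {}a0 : 0 < a by rewrite lt_def an0.
(* With these, (m a)^(p/(p-1)) = m w^r and 1 + a^p = (m + w)/m. Up to a positive factor, the
   logarithm of the claim becomes [one_variable_ineq]. *)
pose w := m%:R * a `^ p; pose r := (p - 1)^-1.
have w0 : 0 < w by rewrite mulr_gt0 // powR_gt0.
have r1 : 1 <= r by rewrite invf_ge1 // lerBlDr.
have rq : r * (p - 1) = 1 by rewrite mulVf // gt_eqF.
have hr : m%:R * r * (ln m.+1%:R - ln m%:R) <= ln (m.+1%:R : R).
  move: K0; rewrite /ln_step pmulr_lge0 ?invr_gt0 //.
  have r0 : 0 <= r by apply: le_trans r1.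
  move=> /(mulr_ge0 r0); rewrite mulrDr mulrA rq mul1r.
  by clear; lra.
have E : (m%:R * a) `^ (p / (p - 1)) = m%:R * w `^ r.
  rewrite -/r powRM ?(ltW mR) ?(ltW a0) // /w powRM ?(ltW mR) ?(ltW ap) //.
  rewrite -powRrM mulrA -[X in X * m%:R `^ r](powRr1 (ltW mR)) -powRD; last first.
    by rewrite (gt_eqF mR) implybT.
  by congr (_ `^ _ * _); rewrite -[X in X + r]rq; ring.
rewrite E; have wr := powR_gt0 r w0.
have pos : 0 < 1 + m%:R * w `^ r by rewrite addr_gt0 // mulr_gt0.
rewrite -ler_ln ?posrE ?mulr_gt0 ?powR_gt0 ?expR_gt0 ?exprn_gt0 //.
rewrite lnM ?posrE ?powR_gt0 ?expR_gt0 ?exprn_gt0 // !ln_powR lnXn // expRK.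
have -> : ln (1 + a `^ p) = ln (m%:R + w) - ln m%:R.
  rewrite -ln_div ?posrE ?addr_gt0 //; congr ln.
  by rewrite /w; field; rewrite gt_eqF.
have := one_variable_ineq m0 r1 w0 hr.
rewrite /ln_step; move: (ln m.+1%:R) (ln m%:R) (ln (m%:R + w)) (ln (1 + _)) => A B C D H1.
rewrite -(ler_pM2l p0).
have -> : p * ((p / (p - 1))^-1 * D) = (p - 1) * D by field; rewrite !gt_eqF.
have -> : p * (((p - 1) * A + m%:R * (B - A)) / p + p^-1 * ((C - B) *+ m)) = 
   (p - 1) * A + m%:R * (C - A).
  by rewrite -mulr_natl; field; rewrite gt_eqF.
have := ler_wpM2l (ltW q0) H1.
have -> : (p - 1) * (m%:R * r * A - A) = m%:R * (r * (p - 1)) * A - (p - 1) * A by ring.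
have -> : (p - 1) * (m%:R * r * C - D) = m%:R * (r * (p - 1)) * C - (p - 1) * D by ring.
rewrite rq; clear; lra.
Qed.

(** * The shape of ln (1 + x^p) and the reduction to two values *)

(** The convex function x^(1-p) + x is minimal where x^p = p - 1. The last hypothesis puts x on the
    side of a away from that point, so the tangent at a does not descend towards x. *)
Lemma xDpowR_min p x a : 1 < p -> 0 < x -> 0 < a ->
  0 <= (x - a) * (a `^ p - (p - 1)) ->
  a `^ (1 - p) + a <= x `^ (1 - p) + x.
Proof.
move=> p1 x0 a0 h.
have H : 1 - p <= 0 by lra.
have := powR_tangent H x0 a0.
have -> : 1 - p - 1 = - p by ring.
rewrite powRN; have ap := powR_gt0 p a0.
have : 0 <= (x - a) * (a `^ p - (p - 1)) / a `^ p by rewrite divr_ge0 // ltW.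
have -> : (x - a) * (a `^ p - (p - 1)) / a `^ p = (x - a) + (1 - p) / a `^ p * (x - a).
  by field; rewrite gt_eqF.
by clear; lra.
Qed.

Definition dln1DpowR p x : R := p * x `^ (p - 1) / (1 + x `^ p).

Lemma is_derive_ln1DpowR p x : 0 < x ->
  is_derive x 1 (fun y => ln (1 + y `^ p)) (dln1DpowR p x).
Proof.
move=> x0; have := is_derive_ln1DMpowR p ler01 x0.
rewrite /dln1DpowR !mul1r.
by under [X in is_derive _ _ X _]funext => y do rewrite mul1r.
Qed.

(** The derivative equals p / (x^(1-p) + x): it increases up to the point where x^p = p - 1 and
    decreases afterwards, so this point is the inflection of ln (1 + x^p). *)
Lemma dln1DpowR_le p x a : 1 < p -> 0 < x -> 0 < a ->
  0 <= (x - a) * (a `^ p - (p - 1)) -> dln1DpowR p x <= dln1DpowR p a.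
Proof.
move=> p1 x0 a0 /(xDpowR_min p1 x0 a0) H.
have E y : 0 < y -> dln1DpowR p y = p / (y `^ (1 - p) + y).
  move=> y0; rewrite /dln1DpowR (_ : 1 - p = - (p - 1)); last by ring.
  rewrite powRN (powR_split p y0); have := powR_gt0 (p - 1) y0 => yp.
  by field; rewrite !gt_eqF //= addr_gt0 // mulr_gt0.
rewrite !E // ler_pM2l; last by lra.
by rewrite lef_pV2 ?posrE ?addr_gt0 ?powR_gt0.
Qed.

(** Above the inflection point ln (1 + x^p) is concave, so lowering the smaller of u, v to c and
    raising the larger by the same amount cannot increase the sum of logarithms. *)
Lemma spread_pair p c u v : 1 < p -> 0 < c -> c `^ p = p - 1 -> c <= u -> c <= v ->
  (1 + c `^ p) * (1 + (u + v - c) `^ p) <= (1 + u `^ p) * (1 + v `^ p).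
Proof.
move=> p1 c0 cp.
wlog uv : u v / u <= v.
  move=> H cu cv; have [uv|/ltW vu] := leP u v; first exact: H.
  by rewrite [u + v]addrC [leRHS]mulrC; apply: H.
move=> cu cv.
have pos x : 0 < 1 + x `^ p by rewrite ltr_pwDl // powR_ge0.
rewrite -ler_ln ?posrE ?mulr_gt0 // !lnM ?posrE //.
have [->|uc] := eqVneq u c; first by rewrite [c + v]addrC addrK.
have {}cu : c < u by rewrite lt_def uc.
have v0 : 0 < v by apply: lt_le_trans cv.
have vlt : v < u + v - c by lra.
have D (x : R) := @is_derive_ln1DpowR p x.
have [x /andP[cx xu] Ex] := MVT_pos c0 cu D.
have [y /andP[vy _] Ey] := MVT_pos v0 vlt D.
have x0 : 0 < x by apply: lt_trans cx.
have y0 : 0 < y by apply: lt_trans vy.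
have : dln1DpowR p y <= dln1DpowR p x.
  apply: dln1DpowR_le => //; rewrite mulr_ge0 //; first by lra.
  by rewrite -cp subr_ge0 ge0_ler_powR ?nnegrE ?ltW //; lra.
have uc0 : 0 <= u - c by rewrite subr_ge0 ltW.
move=> /(ler_wpM2r uc0).
move: Ex Ey; have -> : u + v - c - v = u - c by ring.
lra.
Qed.

(** Up to the inflection point the function is convex and lies above its tangents. The derivative is
    available for x > 0 only, so x = 0 is treated by hand. *)
Lemma ln1DpowR_tangent p a x : 1 < p -> 0 < a -> a `^ p <= p - 1 ->
  0 <= x -> x `^ p <= p - 1 ->
  ln (1 + a `^ p) + dln1DpowR p a * (x - a) <= ln (1 + x `^ p).
Proof.
move=> p1 a0 ap x0 xp.
have [->|xn0] := eqVneq x 0.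
  rewrite powR0 ?gt_eqF ?(lt_trans _ p1) // addr0 ln1 sub0r.
  have H := powR_gt0 p a0.
  rewrite /dln1DpowR (_ : _ * - a = - (p * (a * a `^ (p - 1)) / (1 + a `^ p))); last first.
    by ring.
  rewrite -(powR_split p a0) subr_le0 ler_pdivlMr ?addr_gt0 //.
  (* With y = a^p the goal is (1 + y) ln (1 + y) <= p y, which follows from ln (1 + y) <= y and 1 +
     y <= p. *)
  have : ln (1 + a `^ p) <= a `^ p by rewrite le_ln1Dx // (lt_trans _ H).
  have : 0 <= ln (1 + a `^ p) by rewrite ln_ge0 // lerDl ltW.
  nra.
have {}x0 : 0 < x by rewrite lt_def xn0.
have D (y : R) := @is_derive_ln1DpowR p y.
have sub y b : 0 < y -> y <= b -> b `^ p <= p - 1 -> y `^ p <= p - 1.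
  move=> y0 yb; apply: le_trans; apply: ge0_ler_powR => //.
  - exact: ltW (lt_trans ltr01 p1).
  - by rewrite nnegrE ltW.
  - by rewrite nnegrE (le_trans (ltW y0)).
have [xa|ax|->] := ltgtP x a; last by rewrite subrr mulr0 addr0.
- have [y /andP[xy ya] E] := MVT_pos x0 xa D.
  have y0 : 0 < y by apply: lt_trans xy.
  have : dln1DpowR p y <= dln1DpowR p a.
    by apply: dln1DpowR_le => //; rewrite mulr_le0 // subr_le0 // ltW.
  have xa0 : 0 <= a - x by rewrite subr_ge0 ltW.
  move=> /(ler_wpM2r xa0); lra.
- have [y /andP[ay yx] E] := MVT_pos a0 ax D.
  have y0 : 0 < y by apply: lt_trans ay.
  have : dln1DpowR p a <= dln1DpowR p y.
    apply: dln1DpowR_le => //; rewrite mulr_le0 // subr_le0; first by rewrite ltW.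
    by apply: sub xp => //; rewrite ltW.
  have xa0 : 0 <= x - a by rewrite subr_ge0 ltW.
  move=> /(ler_wpM2r xa0); lra.
Qed.

Definition prod1D p t : R := \prod_(x <- t) (1 + x `^ p).

Lemma prod1D_ge1 p t : 1 <= prod1D p t.
Proof.
rewrite /prod1D; elim: t => [|x t IH]; first by rewrite big_nil.
by rewrite big_cons mulr_ege1 // lerDl powR_ge0.
Qed.

Lemma prod1D_gt0 p t : 0 < prod1D p t.
Proof. exact: lt_le_trans (prod1D_ge1 p t). Qed.

(** Add up the tangent inequalities at the mean [a]; the linear terms cancel. *)
Lemma jensen_prod1D p c t : 1 < p -> 0 < c -> c `^ p = p - 1 ->
  all (fun x => 0 <= x <= c) t ->
  (1 + ((\sum_(x <- t) x) / (size t)%:R) `^ p) ^+ size t <= prod1D p t.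
Proof.
move=> p1 c0 cp tP; have p0 : 0 < p by apply: lt_trans p1.
have [/size0nil ->|sn0] := eqVneq (size t) 0%N; first by rewrite expr0 prod1D_ge1.
have s0 : 0 < (size t)%:R :> R by rewrite ltr0n lt0n.
set a := _ / _.
have sumP : 0 <= \sum_(x <- t) x <= c *+ size t.
  elim: t tP {sn0 s0 a} => [|x t IH] /=; first by rewrite big_nil mulr0n lexx.
  move=> /andP[/andP[x0 xc] /IH /andP[t0 tc]].
  by rewrite big_cons mulrS addr_ge0 //= lerD.
have sumE : \sum_(x <- t) x = (size t)%:R * a by rewrite /a mulrC divfK // gt_eqF.
have pow_le x : 0 <= x -> x <= c -> x `^ p <= p - 1.
  by move=> x0 xc; rewrite -cp ge0_ler_powR ?nnegrE // ltW.
have [a0|an0] := eqVneq a 0.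
  by rewrite a0 powR0 ?gt_eqF // addr0 expr1n prod1D_ge1.
have a0 : 0 < a.
  by case/andP: sumP => h _; rewrite lt_def an0 divr_ge0 // ltW.
have ac : a <= c.
  case/andP: sumP => _; rewrite sumE -[c *+ _]mulr_natl ler_pM2l //.
have pos : 0 < 1 + a `^ p by rewrite ltr_pwDl // powR_ge0.
rewrite -ler_ln ?posrE ?exprn_gt0 ?prod1D_gt0 // lnXn //.
clearbody a.
have : ln (1 + a `^ p) *+ size t + dln1DpowR p a * (\sum_(x <- t) x - a *+ size t)
    <= ln (prod1D p t).
  rewrite /prod1D; elim: t tP {sn0 s0 sumP sumE} => [|x t IH] /=.
    by move=> _; rewrite !big_nil !mulr0n ln1 subrr mulr0 addr0.
  move=> /andP[/andP[x0 xc] tP]; have {}IH := IH tP.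
  rewrite !big_cons lnM ?posrE ?prod1D_gt0 ?ltr_pwDl ?powR_ge0 //.
  have := ln1DpowR_tangent p1 a0 (pow_le _ (ltW a0) ac) x0 (pow_le _ x0 xc).
  by rewrite !mulrS; move: IH; clear; lra.
by rewrite sumE -[a *+ _]mulr_natl subrr mulr0 addr0.
Qed.

(* All but one of the numbers can be pushed below the inflection point [c] of
   [ln (1 + x^p)] without changing the sum or increasing the product. *)
Lemma spread_seq p c x t : 1 < p -> 0 < c -> c `^ p = p - 1 ->
  all (fun y => 0 <= y) (x :: t) ->
  exists b t', [/\ 0 <= b, size t' = size t, all (fun y => 0 <= y <= c) t',
    b + \sum_(y <- t') y = \sum_(y <- x :: t) y &
    (1 + b `^ p) * prod1D p t' <= prod1D p (x :: t)].
Proof.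
move=> p1 c0 cp; rewrite /prod1D; elim: t x => [|y t IH] x /=.
  by rewrite andbT => x0; exists x, [::]; rewrite !big_cons !big_nil.
move=> /and3P[x0 y0 t0].
have [|b [t' [b0 st' t'P tS tprod]]] := IH y; first by rewrite /= y0.
have t'0 := prod1D_gt0 p t'.
have pos z : 0 < 1 + z `^ p by rewrite ltr_pwDl // powR_ge0.
rewrite [\sum_(_ <- x :: _) _]big_cons -tS [\prod_(_ <- x :: _) _]big_cons.
rewrite big_cons in tprod.
have [xc|/ltW cx] := leP x c.
  exists b, (x :: t'); rewrite /= x0 xc st' !big_cons; split=> //.
    by rewrite addrCA.
  by rewrite mulrCA ler_wpM2l // ltW.
have [bc|/ltW cb] := leP b c.
  exists x, (b :: t'); rewrite /= b0 bc st' !big_cons; split=> //.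
  by rewrite ler_wpM2l // ltW.
(* Both [x] and [b] are at least c: one is lowered to c and the other absorbs the excess. *)
exists (x + b - c), (c :: t'); rewrite /= (ltW c0) lexx st' !big_cons; split=> //.
- by rewrite subr_ge0 (le_trans cx) // lerDl.
- by rewrite addrA subrK addrA.
apply: (@le_trans _ _ ((1 + x `^ p) * ((1 + b `^ p) * prod1D p t'))).
  rewrite !mulrA ler_wpM2r ?(ltW t'0) // mulrC.
  exact: spread_pair.
by rewrite ler_wpM2l // ltW.
Qed.

(** * The column inequality for arbitrary tuples *)

(** After spreading, [jensen_prod1D] replaces the m small entries by their mean, and [two_values]
    finishes. *)
Lemma sum_le_prod1D_step (m : nat) p t : (0 < m)%N -> 1 < p -> p <= 2 ->
  0 <= ln_step m p -> all (fun x => 0 <= x) t -> (size t <= m.+1)%N ->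
  \sum_(x <- t) x <= expR (ln_step m p) * prod1D p t `^ p^-1.
Proof.
move=> m0 p1 p2 K0 t0 st; have p0 : 0 < p by apply: lt_trans p1.
(* Padding with zeros changes neither the sum nor the product. *)
wlog {st} st : t t0 / size t = m.+1.
  move=> H; have := H (t ++ nseq (m.+1 - size t) 0).
  rewrite all_cat t0 all_nseq lexx orbT size_cat size_nseq subnKC //.
  move=> /(_ isT erefl); rewrite /prod1D !big_cat /= !big_nseq.
  rewrite powR0 ?gt_eqF // addr0.
  set k := (m.+1 - size t)%N.
  have -> : iter k ( *%R 1) 1 = 1 :> R by elim: k => //= k ->; rewrite mulr1.
  have -> : iter k ( +%R 0) 0 = 0 :> R by elim: k => //= k ->; rewrite addr0.
  by rewrite addr0 mulr1.
have q0 : 0 < p - 1 by rewrite subr_gt0.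
pose c := (p - 1) `^ p^-1.
have c0 : 0 < c by rewrite powR_gt0.
have cp : c `^ p = p - 1 by rewrite -powRrM mulVf ?gt_eqF // powRr1 ?ltW.
case: t t0 st => // x t t0 [st].
have [b [t' [b0 st' t'P <- le]]] := spread_seq p1 c0 cp t0.
have sizet' : size t' = m by rewrite st'.
have mR : 0 < m%:R :> R by rewrite ltr0n.
have J := jensen_prod1D p1 c0 cp t'P.
rewrite sizet' in J; set a := _ / _ in J.
have a0 : 0 <= a.
  rewrite divr_ge0 ?(ltW mR) // big_seq sumr_ge0 // => y yt.
  by have /andP[] := allP t'P y yt.
have -> : \sum_(y <- t') y = m%:R * a by rewrite /a mulrC divfK // gt_eqF.
apply: le_trans (two_values m0 p1 p2 a0 b0 K0) _.
have pos z : 0 < 1 + z `^ p by rewrite ltr_pwDl // powR_ge0.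
rewrite ler_wpM2l ?expR_ge0 // ge0_ler_powR ?nnegrE ?invr_ge0 ?(ltW p0) //.
- by rewrite mulr_ge0 ?exprn_ge0 // ltW.
- exact: ltW (prod1D_gt0 _ _).
by apply: le_trans le; rewrite ler_wpM2l // ltW.
Qed.

(** For two terms, the ratios x/(x+y) and y/(x+y) lie in [0,1], add up to 1, and do not decrease
    when raised to the power s. *)
Lemma powR_sum_le s t : 0 < s -> s <= 1 -> all (fun x => 0 <= x) t ->
  (\sum_(x <- t) x) `^ s <= \sum_(x <- t) x `^ s.
Proof.
move=> s0 s1; have sub x y : 0 <= x -> 0 <= y -> (x + y) `^ s <= x `^ s + y `^ s.
  move=> x0 y0; have [->|xy0] := eqVneq (x + y) 0.
    by rewrite powR0 ?gt_eqF // addr_ge0 ?powR_ge0.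
  have {}xy0 : 0 < x + y by rewrite lt_def xy0 addr_ge0.
  have le1 z : 0 <= z -> z <= x + y -> z / (x + y) <= (z / (x + y)) `^ s.
    move=> z0 zxy; have [->|zn0] := eqVneq z 0.
      by rewrite mul0r powR_ge0.
    have {}z0 : 0 < z by rewrite lt_def zn0.
    by apply: ger1_powR => //; rewrite divr_gt0 //= ler_pdivrMr // mul1r.
  have powE z : 0 <= z -> z `^ s = (z / (x + y)) `^ s * (x + y) `^ s.
    move=> z0; rewrite -powRM ?divr_ge0 ?(ltW xy0) // divfK // gt_eqF //.
  rewrite (powE x) // (powE y) // -mulrDl ler_peMl ?powR_ge0 //.
  have := le1 x x0; rewrite lerDl => /(_ y0) hx.
  have := le1 y y0; rewrite lerDr => /(_ x0) hy.
  by apply: le_trans (lerD hx hy); rewrite -mulrDl divff // gt_eqF.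
elim: t => [|x t IH] /=; first by rewrite !big_nil powR0 ?gt_eqF.
move=> /andP[x0 t0]; rewrite !big_cons; apply: le_trans (sub _ _ x0 _) _.
  by rewrite big_seq sumr_ge0 // => y /(allP t0).
by rewrite lerD2l IH.
Qed.

(** Induction on the exponent with the base fixed: (k + 1)(1 + 1/m) <= k + 2 as long as k + 1 <=
    m. *)
Lemma expn_1DVn_le (m : nat) : (0 < m)%N -> (1 + m%:R^-1) ^+ m <= m.+1%:R :> R.
Proof.
move=> m0; have mR : 0 < m%:R :> R by rewrite ltr0n.
suff H k : (k <= m)%N -> (1 + m%:R^-1) ^+ k <= k.+1%:R :> R by exact: H.
elim: k => [_|k IH km]; first by rewrite expr0.
have i0 : 0 < m%:R^-1 :> R by rewrite invr_gt0.
rewrite exprSr; apply: (@le_trans _ _ (k.+1%:R * (1 + m%:R^-1))).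
  by rewrite ler_wpM2r ?IH ?addr_ge0 ?(ltW i0) // ltnW.
rewrite mulrDr mulr1 -[k.+2%:R]natr1 lerD2l ler_pdivrMr // mul1r.
by rewrite ler_nat.
Qed.

Definition step_factor (m : nat) p : R := Num.max 1 (expR (ln_step m p)).

Lemma sum_le_prod1D (m : nat) p t : (0 < m)%N -> 1 < p -> p <= 2 ->
  all (fun x => 0 <= x) t -> (size t <= m.+1)%N ->
  \sum_(x <- t) x <= step_factor m p * prod1D p t `^ p^-1.
Proof.
move=> m0 p1 p2 t0 st; have p0 : 0 < p by apply: lt_trans p1.
have [K0|K0] := leP 0 (ln_step m p).
  apply: le_trans (sum_le_prod1D_step m0 p1 p2 K0 t0 st) _.
  by rewrite ler_wpM2r ?powR_ge0 // le_max lexx orbT.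
have mR : 0 < m%:R :> R by rewrite ltr0n.
have i0 : 0 < m%:R^-1 :> R by rewrite invr_gt0.
have m1 : 1 < m.+1%:R :> R by rewrite ltr1n.
have L0 : 0 < ln m.+1%:R :> R by rewrite ln_gt0.
(* The exponent at which [ln_step m] vanishes; [expn_1DVn_le] shows that it is at most 2. *)
pose p' : R := 1 + m%:R * (ln m.+1%:R - ln m%:R) / ln m.+1%:R.
have Kp' : ln_step m p' = 0.
  rewrite /ln_step; suff -> : (p' - 1) * ln m.+1%:R + m%:R * (ln m%:R - ln m.+1%:R) = 0.
    by rewrite mul0r.
  by rewrite /p'; field; rewrite gt_eqF.
have pp' : p <= p'.
  rewrite /p' -lerBlDl ler_pdivlMr //.
  move: K0; rewrite /ln_step pmulr_llt0 ?invr_gt0 //.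
  by clear; lra.
have p'2 : p' <= 2.
  suff : m%:R * (ln m.+1%:R - ln m%:R) / ln m.+1%:R <= 1 :> R.
    by rewrite /p' -[2]/(1 + 1); rewrite lerD2l.
  rewrite ler_pdivrMr // mul1r -ln_div ?posrE ?ltr0n // mulr_natl.
  rewrite -lnXn ?divr_gt0 ?ltr0n // ler_ln ?posrE ?exprn_gt0 ?divr_gt0 ?ltr0n //.
  apply: le_trans (expn_1DVn_le m0); rewrite -natr1 mulrDl divff ?gt_eqF //.
  by rewrite mul1r.
have p'1 : 1 < p' by apply: lt_le_trans pp'.
have p'0 : 0 < p' by apply: lt_trans p'1.
pose s := p / p'.
have s0 : 0 < s by rewrite divr_gt0.
have s1 : s <= 1 by rewrite ler_pdivrMr // mul1r.
have S0 : 0 <= \sum_(x <- t) x by rewrite big_seq sumr_ge0 // => y /(allP t0).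
have P0 := ltW (prod1D_gt0 p t).
(* Since (x^s)^p' = x^p, passing to the powers x^s at exponent [p'] keeps the product; subadditivity
   then bounds the sum of the x by (sum of the x^s)^(1/s). *)
have E : prod1D p' [seq x `^ s | x <- t] = prod1D p t.
  rewrite /prod1D big_map; apply: eq_bigr => x _.
  by rewrite -powRrM divfK // gt_eqF.
have := @sum_le_prod1D_step m p' [seq x `^ s | x <- t] m0 p'1 p'2.
rewrite Kp' lexx size_map st all_map E big_map expR0 mul1r => /(_ isT) H.
have {}H := H ltac:(by apply/allP => x _ /=; rewrite powR_ge0) isT.
have {}H := le_trans (powR_sum_le s0 s1 t0) H.
have sV : 0 <= s^-1 by rewrite invr_ge0 ltW.
have := ge0_ler_powR sV _ _ H; rewrite !nnegrE !powR_ge0 => /(_ isT isT).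
rewrite -!powRrM divff ?gt_eqF // powRr1 //.
have -> : p'^-1 / s = p^-1 by rewrite /s; field; rewrite !gt_eqF.
move=> /le_trans; apply.
by rewrite ler_peMl ?powR_ge0 // le_max lexx.
Qed.

End RealInequalities.

Section Permanents.
Context {R : realType}.
Implicit Types (a b c p q r s w : R) (t : seq R).

(** * From the column inequality to permanents *)

Lemma powR_prod (I : finType) (F : I -> R) s : (forall i, 0 <= F i) ->
  (\prod_i F i) `^ s = \prod_i F i `^ s.
Proof.
move=> F0; suff [_ //] : 0 <= \prod_i F i /\ (\prod_i F i) `^ s = \prod_i F i `^ s.
elim/big_rec2: _ => [|i y x _ [x0 <-]]; first by rewrite powR1.
by rewrite mulr_ge0 // powRM.
Qed.

(** The size is only bounded above, so a constant valid for one size serves all smaller sizes. *)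
Definition sum_prod_bound p n C := forall t : seq R,
  all (fun x => 0 <= x) t -> (size t <= n)%N ->
  \sum_(x <- t) x <= C * prod1D p t `^ p^-1.

Lemma le_powRD p a b : 0 < p -> 0 <= a -> 0 <= b -> a <= (a `^ p + b `^ p) `^ p^-1.
Proof.
move=> p0 a0 b0; rewrite -[leLHS](powRr1 a0) -{1}(divff (lt0r_neq0 p0)) powRrM.
by rewrite ge0_ler_powR ?nnegrE ?invr_ge0 ?addr_ge0 ?powR_ge0 ?(ltW p0) // lerDl powR_ge0.
Qed.

(** Here u is a column and v_i stands for the norm of the rest of row i. Dividing by the product of
    the v_i turns the claim into the column inequality for x_i = u_i / v_i. *)
Lemma column_bound m p C (u v : 'I_m.+1 -> R) :
  0 < p -> 1 <= C -> sum_prod_bound p m.+1 C ->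
  (forall i, 0 <= u i) -> (forall i, 0 <= v i) ->
  \sum_k u k * \prod_(i < m) v (lift k i)
    <= C * \prod_i (u i `^ p + v i `^ p) `^ p^-1.
Proof.
move=> p0 C1 Cb u0 v0.
have vprod0 (k : 'I_m.+1) : 0 <= \prod_(i < m) v (lift k i).
  by apply: prodr_ge0.
(* If some v_i vanishes, only the term k = i survives, and it is bounded factor by factor using C >=
   1. *)
have [i0 /eqP vi0|vn0] := pickP (fun i => v i == 0).
  have rest0 k : k != i0 -> u k * \prod_(i < m) v (lift k i) = 0.
    move=> ki; have [j ij] : exists j, i0 = lift k j.
      by case: (unliftP k i0) => [j ->|ki0]; [exists j|rewrite ki0 eqxx in ki].
    by rewrite (bigD1 j) //= -ij vi0 mul0r mulr0.
  rewrite (bigD1 i0) //= [X in _ + X <= _]big1 // addr0 (bigD1_ord i0) //=.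
  rewrite -[leLHS]mul1r; apply: ler_pM => //; first by rewrite mulr_ge0.
  rewrite ler_pM ?le_powRD //; apply: ler_prod => i _.
  by rewrite v0 addrC le_powRD.
have vpos i : 0 < v i by rewrite lt_def vn0 v0.
have -> : \sum_k u k * \prod_(i < m) v (lift k i)
    = (\prod_i v i) * \sum_(x <- [seq u i / v i | i <- enum 'I_m.+1]) x.
  rewrite big_map big_enum big_distrr /=; apply: eq_bigr => k _.
  by rewrite (bigD1_ord k) //=; field; rewrite gt_eqF.
have -> : \prod_i (u i `^ p + v i `^ p) `^ p^-1 = 
    \prod_i v i * prod1D p [seq u i / v i | i <- enum 'I_m.+1] `^ p^-1.
  rewrite /prod1D big_map big_enum powR_prod => [|i]; last first.
    by rewrite addr_ge0 ?powR_ge0.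
  rewrite -big_split; apply: eq_bigr => i _ /=.
  have E : u i `^ p + v i `^ p = v i `^ p * (1 + (u i / v i) `^ p).
    by rewrite mulrDr mulr1 -powRM ?divr_ge0 // mulrC divfK ?gt_eqF // addrC.
  rewrite E powRM ?powR_ge0 ?addr_ge0 ?powR_ge0 //.
  by rewrite -powRrM divff ?gt_eqF // powRr1.
rewrite mulrCA ler_wpM2l ?prodr_ge0 //; apply: Cb.
  by rewrite all_map; apply/allP => i _ /=; rewrite divr_ge0.
by rewrite size_map size_enum_ord.
Qed.

(** A permutation amounts to the image of k and a permutation of the rest; bijectivity follows from
    injectivity by counting. *)
Lemma per_expand_row n (A : 'M[R]_n.+1) k :
  per A = \sum_j A k j * per (row' k (col' j A)).
Proof.
pose h (x : 'I_n.+1 * 'S_n) := lift_perm k x.1 x.2.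
have hinj : injective h.
  move=> [j s] [j' s']; rewrite /h /= => /permP E.
  have jj : j = j' by have := E k; rewrite !lift_perm_id.
  subst j'; congr pair; apply/permP => i.
  by have := E (lift k i); rewrite !lift_perm_lift => /lift_inj.
have hbij : bijective h.
  apply: inj_card_bij hinj _.
  by rewrite card_prod card_ord !card_Sn factS.
rewrite /per (reindex h) /=; last exact: onW_bij.
under [RHS]eq_bigr do rewrite big_distrr /=.
rewrite pair_bigA; apply: eq_bigr => -[j s] _ /=.
rewrite (bigD1_ord k) //= /h /= lift_perm_id; congr (_ * _).
by apply: eq_bigr => i _; rewrite lift_perm_lift !mxE.
Qed.

(** The homogeneous form, with no normalisation of rows, lets the induction apply to minors. *)
Definition per_bound p n c := forall A : 'M[R]_n, (forall i j, 0 <= A i j) ->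
  per A <= c * \prod_i row_lpnorm p A i.

Lemma row_lpnorm_ge0 p n (A : 'M[R]_n) i : 0 <= row_lpnorm p A i.
Proof. exact: powR_ge0. Qed.

Lemma per_bound_le p n c c' : c <= c' -> per_bound p n c -> per_bound p n c'.
Proof.
move=> cc' H A A0; apply: le_trans (H A A0) _.
by rewrite ler_wpM2r // prodr_ge0 // => i _; exact: row_lpnorm_ge0.
Qed.

Lemma per_bound1 p : 0 < p -> per_bound p 1 1.
Proof.
move=> p0 A A0; rewrite /per big_ord1 mul1r.
under eq_bigr => s _ do rewrite big_ord1 [s _]ord1.
rewrite sumr_const card_Sn factS fact0 muln1 mulr1n /row_lpnorm big_ord1.
by rewrite -powRrM divff ?gt_eqF // powRr1 // ler_norm.
Qed.

(* Expand along every row, bound each minor by induction, and sum over rows: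
   the contributions of each column are controlled by [column_bound]. *)
Lemma per_bound_step p m c C : 0 < p -> 0 <= c -> 1 <= C ->
  sum_prod_bound p m.+1 C -> per_bound p m c -> per_bound p m.+1 (c * C).
Proof.
move=> p0 c0 C1 Cb mb A A0.
pose v (j i : 'I_m.+1) := (\sum_(j' < m) `|A i (lift j j')| `^ p) `^ p^-1.
have v0 j i : 0 <= v j i by exact: powR_ge0.
have sum0 (j i : 'I_m.+1) : 0 <= \sum_(j' < m) `|A i (lift j j')| `^ p.
  by apply: sumr_ge0 => j' _; exact: powR_ge0.
have expand k : per A <= \sum_j c * (A k j * \prod_(i < m) v j (lift k i)).
  rewrite (per_expand_row A k); apply: ler_sum => j _.
  have -> : \prod_(i < m) v j (lift k i)
      = \prod_i row_lpnorm p (row' k (col' j A)) i.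
    apply: eq_bigr => i _; rewrite /row_lpnorm /v; congr (_ `^ _).
    by apply: eq_bigr => i' _; rewrite !mxE.
  rewrite mulrCA; apply: ler_wpM2l; first exact: A0.
  by apply: mb => i i'; rewrite !mxE.
have : per A *+ m.+1 <= (c * C * \prod_i row_lpnorm p A i) *+ m.+1.
  have sumC (x : R) : x *+ m.+1 = \sum_(k < m.+1) x.
    by rewrite sumr_const card_ord.
  rewrite !sumC.
  apply: le_trans (ler_sum _ (fun k _ => expand k)) _.
  rewrite exchange_big; apply: ler_sum => j _ /=.
  rewrite -big_distrr -mulrA; apply: ler_wpM2l => //=.
  have -> : \prod_i row_lpnorm p A i = \prod_i (A i j `^ p + v j i `^ p) `^ p^-1.
    apply: eq_bigr => i _; rewrite /row_lpnorm (bigD1_ord j) //=; congr (_ `^ _).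
    by rewrite ger0_norm // /v -powRrM mulVf ?gt_eqF // powRr1.
  exact: column_bound p0 C1 Cb (fun i => A0 i j) (v0 j).
by rewrite lerMn2r.
Qed.

(** * Growth of n!/n^(n/p) and the upper bound *)

Definition fact_ratio n p : R := n`!%:R / n%:R `^ (n%:R / p).

Lemma fact_ratio_gt0 n p : (0 < n)%N -> 0 < fact_ratio n p.
Proof. by move=> n0; rewrite divr_gt0 ?powR_gt0 ?ltr0n // fact_gt0. Qed.

Lemma fact_ratioS m p : (0 < m)%N -> 0 < p ->
  fact_ratio m.+1 p = fact_ratio m p * expR (ln_step m p).
Proof.
move=> m0 p0; have F0 := fact_ratio_gt0 p m0; have FS0 := fact_ratio_gt0 p (ltn0Sn m).
apply: ln_inj; rewrite ?posrE //; first by rewrite mulr_gt0 ?expR_gt0.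
rewrite lnM ?posrE ?expR_gt0 ?fact_ratio_gt0 // expRK /fact_ratio.
rewrite !ln_div ?posrE ?powR_gt0 ?ltr0n ?fact_gt0 // !ln_powR.
rewrite factS natrM lnM ?posrE ?ltr0n ?fact_gt0 // /ln_step -natr1.
by field; rewrite gt_eqF.
Qed.

(* [m!/m^(m/p) >= exp(m (p-1)/p ln m - m)], and the right-hand exponent is
   minimal at [ln m = 1/(p-1)]. *)
Lemma fact_ratio_lb m p : (0 < m)%N -> 1 < p ->
  1 <= expR ((p - 1) / p * expR (p - 1)^-1) * fact_ratio m p.
Proof.
case: m => // m _ p1; have p0 : 0 < p by apply: lt_trans p1.
have q0 : 0 < p - 1 by rewrite subr_gt0.
have n0 : 0 < m.+1%:R :> R by rewrite ltr0n.
have f0 : 0 < m.+1`!%:R :> R by rewrite ltr0n fact_gt0.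
have F0 := fact_ratio_gt0 p (ltn0Sn m).
rewrite -ler_ln ?posrE //; last by rewrite mulr_gt0 ?expR_gt0.
rewrite ln1.
rewrite lnM ?posrE ?expR_gt0 ?fact_ratio_gt0 // expRK /fact_ratio.
rewrite ln_div ?posrE ?powR_gt0 // ln_powR.
(* A single term of the exponential series gives n^n/n! <= e^n. *)
have stirling : m.+1%:R * ln m.+1%:R - m.+1%:R <= ln m.+1`!%:R :> R.
  rewrite lerBlDl -lerBlDr mulr_natl -lnXn // -ln_div ?posrE ?exprn_gt0 //.
  rewrite -[leRHS]expRK ler_ln ?posrE ?expR_gt0 ?divr_gt0 ?exprn_gt0 //.
  by have := expR_ge1Dxn m (ltW n0); apply: le_trans; rewrite lerDr.
set n := m.+1%:R in n0 stirling *; set L := ln n in stirling *.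
(* The inequality ln z <= z - 1 is taken at z = e^(1/(p-1))/n, which is 1 exactly at the
   minimiser. *)
have := @ln_leB1 R (expR (p - 1)^-1 / n).
rewrite divr_gt0 ?expR_gt0 // => /(_ isT).
rewrite ln_div ?posrE ?expR_gt0 // expRK -/L.
set e := expR _ => H.
have : 0 <= (p - 1) / p * n * (e / n - 1 - ((p - 1)^-1 - L)).
  by rewrite !mulr_ge0 ?invr_ge0 ?subr_ge0 ?(ltW p0) ?(ltW n0) ?(ltW p1).
have -> : (p - 1) / p * n * (e / n - 1 - ((p - 1)^-1 - L)) =
  (p - 1) / p * e - n + (n * L - n / p * L).
  by field; rewrite !gt_eqF.
by move: stirling; clear; lra.
Qed.

Lemma sum_prod_bound_step_factor m p : (0 < m)%N -> 1 < p -> p <= 2 ->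
  sum_prod_bound p m.+1 (step_factor m p).
Proof. by move=> m0 p1 p2 t; apply: sum_le_prod1D. Qed.

Lemma per_bound_fact_ratio n p : (0 < n)%N -> 1 < p -> p <= 2 ->
  per_bound p n (expR ((p - 1) / p * expR (p - 1)^-1) * fact_ratio n p).
Proof.
move=> n0 p1 p2; have p0 : 0 < p by apply: lt_trans p1.
set E := expR _; elim: n n0 => // m IH _.
have [->|mn0] := eqVneq m 0%N.
  by apply: per_bound_le (per_bound1 p0); apply: fact_ratio_lb.
have m0 : (0 < m)%N by rewrite lt0n.
have Cb := sum_prod_bound_step_factor m0 p1 p2.
have C1 : 1 <= step_factor m p by rewrite le_max lexx.
have [K0|K0] := leP 0 (ln_step m p).
  have CE : step_factor m p = expR (ln_step m p).
    by apply/max_idPr; rewrite -expR0 ler_expR.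
  rewrite fact_ratioS // mulrA -CE; apply: per_bound_step (IH m0) => //.
  by rewrite mulr_ge0 ?expR_ge0 // ltW // fact_ratio_gt0.
have CE : step_factor m p = 1.
  by apply/max_idPl; rewrite -expR0 ler_expR ltW.
(* Constant 1 works in the column inequality for size m + 1, hence for all smaller sizes: the
   induction is rerun from size 1 with constant 1, and [fact_ratio_lb] absorbs the resulting bound
   1. *)
rewrite CE in Cb; apply: per_bound_le (fact_ratio_lb _ p1) _ => //.
suff H j : (j <= m)%N -> per_bound p j.+1 1 by exact: H.
elim: j => [_|j IHj jm]; first exact: per_bound1.
rewrite -[1]mulr1; apply: per_bound_step => //; last by apply: IHj; exact: ltnW.
by move=> t t0 st; apply: Cb => //; apply: leq_trans st _.
Qed.

Lemma per_le_abs n (A : 'M[R]_n) : per A <= per (map_mx Num.norm A).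
Proof.
apply: ler_sum => s _; apply: le_trans (ler_norm _) _.
by rewrite normr_prod; under [leRHS]eq_bigr do rewrite mxE.
Qed.

Lemma per_le_fact_ratio n p (A : 'M[R]_n) : (0 < n)%N -> 1 < p -> p <= 2 ->
  (forall i, row_lpnorm p A i = 1) ->
  per A <= expR ((p - 1) / p * expR (p - 1)^-1) * fact_ratio n p.
Proof.
move=> n0 p1 p2 A1; apply: le_trans (per_le_abs A) _.
apply: le_trans (per_bound_fact_ratio n0 p1 p2 _) _.
  by move=> i j; rewrite mxE.
rewrite big1 ?mulr1 // => i _; rewrite -[RHS](A1 i) /row_lpnorm.
by under eq_bigr do rewrite mxE normr_id.
Qed.

(** * The matrices behind the lower bound, and the conclusion *)

Lemma per_scalar_ge1 n : 1 <= per (1%:M : 'M[R]_n).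
Proof.
rewrite /per (bigD1 1%g) //= [X in X + _]big1 => [|i _]; last first.
  by rewrite perm1 mxE eqxx.
rewrite lerDl sumr_ge0 // => s _; rewrite prodr_ge0 // => i _.
by rewrite mxE ler0n.
Qed.

Lemma row_lpnorm_scalar n p i : 0 < p -> row_lpnorm p (1%:M : 'M[R]_n) i = 1.
Proof.
move=> p0; rewrite /row_lpnorm (bigD1 i) //= big1 => [|j ji].
  by rewrite mxE eqxx normr1 addr0 !powR1.
by rewrite mxE eq_sym (negPf ji) normr0 powR0 // gt_eqF.
Qed.

Lemma per_const n a : per (const_mx a : 'M[R]_n) = n`!%:R * a ^+ n.
Proof.
rewrite /per; under eq_bigr => s _.
  under eq_bigr do rewrite mxE.
  rewrite prodr_const card_ord; over.
by rewrite sumr_const card_Sn [RHS]mulr_natl.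
Qed.

Lemma row_lpnorm_const n p i : (0 < n)%N -> 0 < p ->
  row_lpnorm p (const_mx (n%:R `^ (- p^-1)) : 'M[R]_n) i = 1.
Proof.
move=> n0 p0; have nR : 0 < n%:R :> R by rewrite ltr0n.
rewrite /row_lpnorm; under eq_bigr do rewrite mxE ger0_norm ?powR_ge0 // -powRrM mulNr.
rewrite mulVf ?gt_eqF // sumr_const card_ord powR_inv1 ?ltW //.
by rewrite -[_^-1 *+ _]mulr_natl divff ?gt_eqF // powR1.
Qed.

Lemma per_const_fact_ratio n p :
  per (const_mx (n%:R `^ (- p^-1)) : 'M[R]_n) = fact_ratio n p.
Proof.
rewrite per_const /fact_ratio -powR_mulrn ?powR_ge0 // -powRrM mulNr powRN.
by rewrite [p^-1 * _]mulrC.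
Qed.

End Permanents.

Theorem theorem1p3 (R : realType) (n : nat) (p : R) :
  (2 <= n)%N ->
  (n%:R * ln (n%:R : R) - (n.-1)%:R * ln ((n.-1)%:R : R)) / ln (n%:R : R) <= p ->
  p <= 2 ->
  Num.max 1 (n`!%:R / ((n%:R : R) `^ (n%:R / p))) <= U n p /\
  U n p <= expR ((p - 1) / p * expR (p - 1)^-1) * (n`!%:R / ((n%:R : R) `^ (n%:R / p))).
Proof.
move=> n2 pn p2; rewrite -/(fact_ratio n p).
have n0 : (0 < n)%N by apply: leq_trans n2.
(* The lower limit for p exceeds 1 by (n-1)(ln n - ln (n-1))/ln n > 0. *)
have p1 : 1 < p.
  apply: lt_le_trans pn; case: n n2 {n0} => [|[|m]] // _ /=.
  have L0 : 0 < ln m.+2%:R :> R by rewrite ln_gt0 // ltr1n.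
  rewrite ltr_pdivlMr // mul1r -[in X in X * _]natr1 mulrDl mul1r.
  rewrite -addrA addrCA ltrDl subr_gt0 ltr_pM2l ?ltr0n //.
  by rewrite ltr_ln ?posrE ?ltr0n // ltr_nat.
have p0 : 0 < p by apply: lt_trans p1.
have ub : ubound [set per A | A in [set A : 'M[R]_n | forall i, row_lpnorm p A i = 1]]%classic
    (expR ((p - 1) / p * expR (p - 1)^-1) * fact_ratio n p).
  by move=> _ [A A1 <-]; exact: per_le_fact_ratio.
have le_U (A : 'M[R]_n) : (forall i, row_lpnorm p A i = 1) -> per A <= U n p.
  move=> A1; apply: ub_le_sup; last by exists A.
  by eexists; exact: ub.
have scalar1 i : row_lpnorm p (1%:M : 'M[R]_n) i = 1 by exact: row_lpnorm_scalar.
(* The identity matrix shows that the supremum is over a nonempty set. *)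
split; last by apply: ge_sup => //; exists (per (1%:M : 'M[R]_n)), 1%:M.
rewrite ge_max; apply/andP; split.
  by apply: le_trans (per_scalar_ge1 n) _; apply: le_U.
rewrite -(per_const_fact_ratio n p); apply: le_U => i.
exact: row_lpnorm_const.
Qed.
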